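(* Let $n\ge 3$ be an integer and let $m\ge 1$ be the largest positive integer such that $\frac{3}{2}(m-1)(m+2)<\binom{n-1}{2}$. Then for every integer $t$ with $\binom{n}{3}+1\le t\le \binom{n}{3}+\binom{m+1}{2}-1$, we have $\phi(t)\le n-1$.
   Context: For a $3$-element subset $T=\{a,b,c\}$ of a totally ordered set with $a<b<c$ and a $2$-element subset $e$, $[T:e]$ is $1$ if $e=\{a,b\}$ or $\{b,c\}$, $-1$ if $e=\{a,c\}$, $0$ if $e\not\subset T$. For a nonempty finite family $\mathcal T$ of $3$-element subsets of a totally ordered set, the support graph $\Gamma_0(\mathcal T)$ has vertex set $\bigcup_{T\in\mathcal T}T$ and edges the pairs contained in some member of $\mathcal T$; $\delta_{1,\mathcal T}$ is the $\mathcal T\times E(\Gamma_0(\mathcal T))$ matrix with entries $[T:e]$, and $\lambda(\mathcal T)$ is the smallest positive eigenvalue of $\delta_{1,\mathcal T}^T\delta_{1,\mathcal T}$. For positive integers $t$, $\phi(t)=\max_{|\mathcal T|=t}\lambda(\mathcal T)$. *)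

(* Defs.v *)
From mathcomp Require Import all_boot all_order all_algebra finmap complex.
From mathcomp Require Import all_classical all_reals.

Set Implicit Arguments.
Unset Strict Implicit.
Unset Printing Implicit Defensive.

Import Order.TTheory GRing.Theory Num.Theory.
Local Open Scope fset_scope.
Local Open Scope ring_scope.

Section SupportGraph.
Context {d : Order.disp_t} {V : orderType d}.
Implicit Types (T e : {fset V}) (F : {fset {fset V}}).

Definition triple_family F : Prop :=
  F != fset0 /\ forall T, T \in F -> #|` T| = 3.

(* [T : e]; the value on sets [T] that do not have 3 elements is irrelevant. *)
Definition incidence (R : pzRingType) T e : R :=
  if sort <=%O (enum_fset T) is [:: a; b; c] then
    if (e == [fset a; b]) || (e == [fset b; c]) then 1
    else if e == [fset a; c] then -1
    else 0
  else 0.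

Definition support_vertices F : {fset V} := \bigcup_(T <- F) T.

Definition support_edges F : {fset {fset V}} :=
  [fset e in fpowerset (support_vertices F) |
     (#|` e| == 2) && [exists T : F, e `<=` val T]].

Definition coboundary (R : pzRingType) F :
    'M[R]_(#|` F|, #|` support_edges F|) :=
  \matrix_(i, j) incidence R (nth fset0 (enum_fset F) i)
                             (nth fset0 (enum_fset (support_edges F)) j).

End SupportGraph.

Local Open Scope classical_set_scope.

Definition positive_eigenvalues (R : realType) n (A : 'M[R]_n) : set R :=
  [set a | eigenvalue A a /\ 0 < a].

Definition lambda (R : realType) d (V : orderType d) (F : {fset {fset V}}) : R :=
  inf (positive_eigenvalues ((coboundary R F)^T *m coboundary R F)).

Definition lambda_values (R : realType) (t : nat) : set R :=
  [set x | exists (d : Order.disp_t) (V : orderType d) (F : {fset {fset V}}),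
    [/\ triple_family F, #|` F| = t & x = lambda R F]].

Definition phi (R : realType) (t : nat) : R := sup (@lambda_values R t).

(* The remaining facts show that [inf] and [sup] above are an attained minimum
   and an attained maximum. *)

Section GramMatrix.
Variables (R : rcfType) (m n : nat) (D : 'M[R]_(m, n)).
Let toC : {rmorphism R -> complex R} := real_complex R.

Let sqnorm k (v : 'rV[complex R]_k) := \sum_i `|v 0 i| ^+ 2.

Let sqnormE k (v : 'rV[complex R]_k) :
  sqnorm v = (v *m (map_mx conjc v)^T) 0 0.
Proof. by rewrite mxE; apply: eq_bigr => i _; rewrite !mxE sqr_normc. Qed.

Let sqnorm_gt0 k (v : 'rV[complex R]_k) : v != 0 -> 0 < sqnorm v.
Proof.
move=> v0; rewrite lt_def sumr_ge0 ?andbT; last by move=> i _; exact: exprn_ge0.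
apply: contraNneq v0 => /eqP.
rewrite psumr_eq0; last by move=> i _; exact: exprn_ge0.
move=> /allP h; apply/eqP/rowP => i; rewrite mxE.
by have := h i (mem_index_enum _); rewrite /= sqrf_eq0 normr_eq0 => /eqP.
Qed.

Let gram_eigenvalue_ge0 (z : complex R) :
  eigenvalue (map_mx toC (D^T *m D)) z -> 0 <= z.
Proof.
move=> /eigenvalueP[v vM v0].
have cD : map_mx conjc (map_mx toC D^T) = map_mx toC D^T.
  by apply/matrixP => i j; rewrite !mxE /= oppr0.
have tD : (map_mx toC D^T)^T = map_mx toC D.
  by apply/matrixP => i j; rewrite !mxE.
have e : sqnorm (v *m map_mx toC D^T) = z * sqnorm v.
  rewrite !sqnormE map_mxM /= cD trmx_mul tD mulmxA.
  by rewrite -(mulmxA v) -map_mxM vM -scalemxAl mxE.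
have : 0 <= sqnorm (v *m map_mx toC D^T).
  by apply: sumr_ge0 => i _; exact: exprn_ge0.
by rewrite e pmulr_lge0 // sqnorm_gt0.
Qed.

Lemma gram_pos_eigenvalue :
  D != 0 -> exists a : R, eigenvalue (D^T *m D) a /\ 0 < a.
Proof.
move=> D0.
have n_gt0 : (0 < n)%N.
  have [n0|//] := posnP n; case/eqP: D0; apply/matrixP => i j; exfalso.
  by have := leq_ltn_trans (leq0n j) (ltn_ord j); rewrite n0.
have tr0 : \tr (D^T *m D) != 0.
  apply: contraNneq D0 => tr0; apply/eqP/matrixP => i j; rewrite mxE.
  have trE : \tr (D^T *m D) = \sum_j \sum_i D i j ^+ 2.
    apply: eq_bigr => k _; rewrite mxE; apply: eq_bigr => l _.
    by rewrite mxE expr2.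
  move: tr0; rewrite trE => /eqP; rewrite psumr_eq0; last first.
    by move=> k _; apply: sumr_ge0 => l _; exact: sqr_ge0.
  move=> /allP/(_ j (mem_index_enum _)) /=; rewrite psumr_eq0; last first.
    by move=> k _; exact: sqr_ge0.
  by move=> /allP/(_ i (mem_index_enum _)) /=; rewrite sqrf_eq0 => /eqP.
have [r rE] := closed_field_poly_normal (char_poly (map_mx toC (D^T *m D))).
rewrite (monicP (char_poly_monic _)) scale1r in rE.
have [/hasP[z zr z0]|/hasPn r0] := boolP (has (fun z => z != 0) r).
  have ez : eigenvalue (map_mx toC (D^T *m D)) z.
    by rewrite eigenvalue_root_char rE root_prod_XsubC.
  have zge0 := gram_eigenvalue_ge0 ez.
  have zE : z = toC (complex.Re z) by rewrite /= RRe_real // ger0_real.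
  exists (complex.Re z); split.
    move: ez; rewrite !eigenvalue_root_char -map_char_poly zE.
    by rewrite fmorph_root.
  by rewrite -ltcR [X in _ < X](esym zE) lt_def z0.
have rX : \prod_(z <- r) ('X - z%:P) = 'X^(size r).
  elim: r r0 {rE} => [|z r IH] r0; first by rewrite big_nil expr0.
  rewrite big_cons IH; last by move=> y yr; apply: r0; rewrite in_cons yr orbT.
  have /eqP -> : z == 0 by have := r0 z (mem_head _ _); rewrite negbK.
  by rewrite subr0 -exprS.
have := size_char_poly (map_mx toC (D^T *m D)); rewrite rE rX size_polyXn => -[szr].
have := char_poly_trace (map_mx toC (D^T *m D)) n_gt0.
rewrite rE rX szr coefXn => /eqP.
rewrite (_ : (n.-1 == n) = false); last by rewrite -(prednK n_gt0) /= ltn_eqF.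
by rewrite eq_sym oppr_eq0 trace_map_mx fmorph_eq0 (negbTE tr0).
Qed.

End GramMatrix.

Lemma finite_set_sup (R : realType) (A : set R) :
  finite_set A -> A !=set0 -> A (sup A) /\ ubound A (sup A).
Proof.
move=> /finite_seqP[s ->] [x0 x0s].
have [x xs xmax] : exists2 x, x \in s & forall y, y \in s -> y <= x.
  elim: s x0 x0s => [//|y s IH] x0 _.
  have [s0|[z zs]] : s = [::] \/ exists z, z \in s.
    by case: s {IH} => [|z s]; [left|right; exists z; exact: mem_head].
    by exists y => [|z]; rewrite ?mem_head // s0 inE => /eqP ->.
  have [x xs xmax] := IH z zs; have [yx|xy] := leP y x.
    exists x => [|w]; first by rewrite in_cons xs orbT.
    by rewrite in_cons => /orP[/eqP -> //|/xmax].
  exists y => [|w]; first exact: mem_head.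
  by rewrite in_cons => /orP[/eqP -> //|/xmax/le_trans]; apply; exact: ltW.
suff -> : sup [set` s] = x by [].
apply/eqP; rewrite eq_le ge_sup //=; last by exists x.
by apply: ub_le_sup => //; exists x.
Qed.

Lemma finite_set_inf (R : realType) (A : set R) :
  finite_set A -> A !=set0 -> A (inf A) /\ lbound A (inf A).
Proof.
move=> Afin [x Ax].
have [] := @finite_set_sup R (-%R @` A).
- exact: finite_image.
- by exists (- x), x.
rewrite /inf => -[y Ay <-] ub; rewrite opprK; split => // z Az.
by rewrite -lerN2; apply: ub; exists z.
Qed.

Lemma finite_positive_eigenvalues (R : realType) n (A : 'M[R]_n) :
  finite_set (positive_eigenvalues A).
Proof.
apply: contrapT => /(infinite_set_fset (size (char_poly A)))[B BA].
rewrite leqNgt => /negP; apply; apply: max_poly_roots.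
- exact/monic_neq0/char_poly_monic.
- by apply/allP => x /BA[+ _]; rewrite eigenvalue_root_char.
- exact: fset_uniq.
Qed.

Section SupportGraphTheory.
Context {d : Order.disp_t} {V : orderType d}.
Variable F : {fset {fset V}}.
Hypothesis triF : triple_family F.

Lemma size_support_edges : (#|` support_edges F| <= #|` F| * 8)%N.
Proof.
have -> : (#|` F| * 8 = size (flatten [seq enum_fset (fpowerset T) | T <- enum_fset F]))%N.
  rewrite size_flatten /shape -map_comp.
  rewrite (_ : map _ _ = nseq (size (enum_fset F)) 8) ?sumn_nseq ?[(8 * _)%N]mulnC //.
  rewrite -(size_map (size \o (fun T => enum_fset (fpowerset T)))).
  apply/all_pred1P/allP => _ /mapP[T TF ->] /=.
  by rewrite card_fpowerset triF.2.
apply: uniq_leq_size; first exact: fset_uniq.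
move=> e; rewrite !inE /= => /and3P[_ _ /existsP[T eT]].
apply/flattenP; exists (enum_fset (fpowerset (val T))).
  by apply: map_f; exact: valP.
by rewrite fpowersetE.
Qed.

Lemma coboundary_neq0 (R : realType) : coboundary R F != 0.
Proof.
have [/fset0Pn[T TF] F3] := triF.
have szT : size (sort <=%O (enum_fset T)) = 3 by rewrite size_sort F3.
case sT : (sort <=%O (enum_fset T)) szT => [|a [|b [|c [|]]]] // _.
have : uniq [:: a; b; c] by rewrite -sT sort_uniq fset_uniq.
rewrite /= !inE => /and3P[/norP[ab _] _ _].
have aT : a \in T by rewrite -(mem_sort <=%O) sT mem_head.
have bT : b \in T by rewrite -(mem_sort <=%O) sT !inE eqxx orbT.
have eT : ([fset a; b] `<=` T)%fset.
  by apply/fsubsetP => x; rewrite !inE => /orP[] /eqP ->.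
have eE : [fset a; b] \in support_edges F.
  rewrite !inE /= fpowersetE cardfs2 ab /=; apply/andP; split.
    apply: (fsubset_trans eT); apply/fsubsetP => x xT.
    by apply/bigfcupP; exists T; rewrite ?TF.
  by apply/existsP; exists [` TF].
apply/eqP => /matrixP.
have iT := TF; rewrite -index_mem in iT; have iE := eE; rewrite -index_mem in iE.
move=> /(_ (Ordinal iT) (Ordinal iE)); rewrite !mxE /= !nth_index //.
by rewrite /incidence sT eqxx /=; apply/eqP; exact: oner_neq0.
Qed.

Lemma lambda_min (R : realType) :
  let S := positive_eigenvalues ((coboundary R F)^T *m coboundary R F) in
  S (lambda R F) /\ forall a, S a -> lambda R F <= a.
Proof.
apply: finite_set_inf; first exact: finite_positive_eigenvalues.
exact: gram_pos_eigenvalue (coboundary_neq0 R).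
Qed.

End SupportGraphTheory.

Lemma finite_lambda_values (R : realType) (t : nat) :
  finite_set (@lambda_values R t).
Proof.
pose dec (x : 'I_3) : R := x%:R - 1.
pose h k (A : 'M['I_3]_(t, k)) : R :=
  inf (positive_eigenvalues ((map_mx dec A)^T *m map_mx dec A)).
suff sub : @lambda_values R t `<=` \bigcup_(k in `I_(t * 8).+1) range (h k).
  apply: sub_finite_set sub _; apply: bigcup_finite => // k _.
  exact/finite_image/finite_finset.
move=> _ [d [V [F [triF Ft ->]]]]; subst t.
exists #|` support_edges F|; first by rewrite /= ltnS size_support_edges.
have decP i j : exists x, dec x = coboundary R F i j.
  rewrite mxE /incidence.
  case: sort => [|a [|b [|c []]]]; try by exists 1; rewrite /dec subrr.
  case: ifP => _; first by exists 2; rewrite /dec /= -addrA subrr addr0.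
  case: ifP => _; first by exists 0; rewrite /dec /= add0r.
  by exists 1; rewrite /dec subrr.
pose c i j := projT1 (cid (decP i j)).
exists (\matrix_(i, j) c i j) => //.
rewrite /h /lambda (_ : map_mx dec _ = coboundary R F) //.
by apply/matrixP => i j; rewrite [LHS]mxE mxE; exact: (projT2 (cid (decP i j))).
Qed.

Lemma lambda_values_neq0 (R : realType) (t : nat) :
  (0 < t)%N -> @lambda_values R t !=set0.
Proof.
move=> t0.
pose f (i : nat) : {fset nat} := [fset 0%N; 1%N; i.+2].
have f_inj : injective f.
  move=> i j /fsetP/(_ i.+2); rewrite !inE eqxx /= => /esym/eqP[] //.
pose F : {fset {fset nat}} := [fset f i | i in iota 0 t].
have cF : #|` F| = t.
  rewrite card_imfset //= undup_id ?iota_uniq ?size_iota //.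
exists (lambda R F), _, nat, F; split => //; split.
  by rewrite -cardfs_eq0 cF -lt0n.
by move=> _ /imfsetP[i _ ->]; rewrite /f -fsetUA !cardfsU1 !inE cardfs1.
Qed.

Lemma phi_max (R : realType) (t : nat) : (0 < t)%N ->
  @lambda_values R t (phi R t) /\ forall x, @lambda_values R t x -> x <= phi R t.
Proof.
move=> t0.
exact: finite_set_sup (finite_lambda_values R t) (lambda_values_neq0 R t0).
Qed.

(* Main.v *)
(** For an edge [e] of the support graph let [d e] be the number of triples that
    contain it.  Every positive eigenvalue of the symmetric matrix
    [S = delta^T delta] is at least [lambda], hence [lambda S <= S ^ 2] as
    quadratic forms.  The diagonal entries at [e] are [S e e = d e] and
    [(S ^ 2) e e = (d e) ^ 2 + 2 (d e)], so [lambda <= d e + 2].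

    If [lambda > n - 1], every edge therefore lies in at least [n - 2] triples,
    so every vertex has at least [n - 1] neighbours.  Counting the flags
    vertex < edge < triple gives [N (n - 1) (n - 2) <= 6 t], where [N] is the
    number of vertices, while the condition on [m] says exactly that
    [6 t < (n + 1) (n - 1) (n - 2)] on the whole range of [t].  Thus [N <= n]
    and [t <= 'C(n, 3)], a contradiction. *)

Require Import Defs.
From mathcomp Require Import all_boot all_order all_algebra.
From mathcomp Require Import finmap complex spectral sesquilinear.
From mathcomp Require Import all_classical all_reals.
From mathcomp Require Import zify lra.

Set Implicit Arguments.
Unset Strict Implicit.
Unset Printing Implicit Defensive.

Import Order.TTheory GRing.Theory Num.Theory.
Local Open Scope fset_scope.
Local Open Scope ring_scope.

(** * A spectral inequality for real symmetric matrices *)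

(** Diagonalise [S] over the complex numbers by a unitary [P]. The diagonal entries of [S] and
    [S *m S] at [j] are sums of the eigenvalues and of their squares with the same weights
    [|P k j| ^+ 2], so it suffices that [l * x <= x ^+ 2] for each eigenvalue [x]. For [x > 0] this
    is [l <= x]; otherwise the left side is nonpositive. *)
Lemma symmetric_sqr_diag_ge (R : rcfType) n (S : 'M[R]_n) (l : R) (j : 'I_n) :
  S^T = S -> 0 <= l -> (forall a, eigenvalue S a -> 0 < a -> l <= a) ->
  l * S j j <= (S *m S) j j.
Proof.
move=> St l0 lmin.
pose toC : {rmorphism R -> complex R} := real_complex R.
pose A := map_mx toC S.
have Aherm : A \is hermsymmx.
  apply: realsym_hermsym.
    apply/is_hermitianmxP; rewrite expr0 scale1r; apply/matrixP => i k.
    by rewrite !mxE -[in LHS]St mxE.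
  by apply/mxOverP => i k; rewrite mxE complex_real.
have [P Punit [D Dreal AE]] : exists2 P : 'M[complex R]_n, P \is unitarymx &
    exists2 D, D \is a realmx & A = invmx P *m diag_mx D *m P.
  exists (spectralmx A); first exact: spectral_unitarymx.
  exists (spectral_diag A); first exact: hermitian_spectral_diag_real.
  exact/orthomx_spectralP/hermitian_normalmx.
have PK : P *m invmx P = 1%:M by rewrite mulmxV // unitarymx_unit.
have AAE : A *m A = invmx P *m diag_mx (\row_k (D 0 k ^+ 2)) *m P.
  rewrite AE !mulmxA -(mulmxA _ P) PK mulmx1.
  rewrite -(mulmxA _ (diag_mx D) (diag_mx D)) mulmx_diag.
  by congr (_ *m diag_mx _ *m _); apply/rowP => k; rewrite !mxE.
have diagE (E : 'rV_n) :
    (invmx P *m diag_mx E *m P) j j = \sum_k `|P k j| ^+ 2 * E 0 k.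
  rewrite mxE; apply: eq_bigr => k _.
  by rewrite mul_mx_diag invmx_unitary // !mxE normCK mulrC mulrA.
rewrite -lecR -/toC.
have -> : real_complex R (l * S j j) = toC l * A j j by rewrite rmorphM /= mxE.
have -> : real_complex R ((S *m S) j j) = (A *m A) j j.
  by rewrite /A -map_mxM [RHS]mxE.
rewrite AAE AE !diagE mulr_sumr; apply: ler_sum => k _; rewrite mulrCA mxE.
apply: ler_wpM2l; first exact: exprn_ge0.
have DE := RRe_real (mxOverP Dreal 0 k).
(* Row [k] of [P] is an eigenvector of [A], nonzero because [P] is invertible. *)
have ev : eigenvalue S (complex.Re (D 0 k)).
  rewrite eigenvalue_root_char -(fmorph_root toC) map_char_poly.
  rewrite -eigenvalue_root_char /= DE.
  apply/eigenvalueP; exists (row k P).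
    rewrite -row_mul -/A AE !mulmxA PK mul1mx.
    by rewrite row_mul row_diag_mx -scalemxAl -rowE.
  apply/negP => /eqP r0; have := congr1 (row k) PK.
  rewrite row_mul r0 mul0mx => /rowP/(_ k); rewrite !mxE eqxx => /eqP.
  by rewrite eq_sym oner_eq0.
rewrite -DE /toC /= -!rmorphXn -!rmorphM lecR expr2.
have [ge0|lt0] := ltP 0 (complex.Re (D 0 k)).
  by apply: ler_wpM2r; [exact: ltW | exact: lmin].
by apply: (@le_trans _ _ 0); [exact: mulr_ge0_le0 | exact: mulr_le0].
Qed.

(** * Pairs, triples and squared incidence numbers *)

Lemma sqr_sum_orthogonal (R : pzRingType) (I : finType) (x : I -> R) :
  (forall i k, i != k -> x i * x k = 0) -> (\sum_i x i) ^+ 2 = \sum_i x i ^+ 2.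
Proof.
move=> x0; rewrite expr2 mulr_suml; apply: eq_bigr => i _.
rewrite mulr_sumr (bigD1 i) //= big1 ?addr0 // => k ki.
by rewrite x0 // eq_sym.
Qed.

Lemma sum_nat_of_bool (I : Type) (r : seq I) (P : pred I) :
  (\sum_(i <- r) (P i : nat) = count P r)%N.
Proof.
by rewrite -sum1_count [RHS]big_mkcond; apply: eq_bigr => i _; case: ifP.
Qed.

Lemma card3_sorted d (V : orderType d) (T : {fset V}) : #|` T| = 3%N ->
  exists a b c, [/\ sort <=%O (enum_fset T) = [:: a; b; c],
    uniq [:: a; b; c] & T =i [:: a; b; c]].
Proof.
move=> T3; have : size (sort <=%O (enum_fset T)) = 3%N by rewrite size_sort.
case sT : (sort <=%O (enum_fset T)) => [|a [|b [|c [|]]]] // _.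
exists a, b, c; split => //; first by rewrite -sT sort_uniq fset_uniq.
by move=> x; rewrite -sT mem_sort.
Qed.

Lemma card2_fset2 (K : choiceType) (e : {fset K}) : #|` e| = 2%N ->
  exists u v, u != v /\ e = [fset u; v].
Proof.
move=> e2; have /fset0Pn[u ue] : e != fset0 by rewrite -cardfs_gt0 e2.
have /cardfs1P[v ev] : #|` e `\ u| == 1%N.
  by move: e2; rewrite (cardfsD1 u) ue add1n => -[->].
exists u, v; split.
  by apply/eqP => uv; have := fset11 v; rewrite -ev -uv !inE eqxx.
by rewrite -(fsetD1K ue) ev.
Qed.

Lemma fsub2set (K : choiceType) (u v : K) (T : {fset K}) :
  ([fset u; v] `<=` T) = (u \in T) && (v \in T).
Proof. by rewrite fsubUset !fsub1set. Qed.

Lemma incidence_sqr (R : pzRingType) d (V : orderType d) (T e : {fset V}) :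
  #|` T| = 3%N -> #|` e| = 2%N -> incidence R T e ^+ 2 = (e `<=` T)%:R.
Proof.
move=> /card3_sorted[a [b [c [sT _ Tabc]]]] /card2_fset2[u [v [uv ->]]].
rewrite /incidence sT fsub2set !Tabc; case: ifP => [|Nabbc].
  by case/orP => /eqP/fsetP E; have := E u; have := E v; rewrite expr1n;
    rewrite !inE !eqxx ?orbT /= => /esym/orP[]/eqP-> /esym/orP[]/eqP->;
    rewrite !eqxx ?orbT.
case: ifP => [/eqP/fsetP E|Nac].
  by have := E u; have := E v; rewrite sqrrN expr1n;
    rewrite !inE !eqxx ?orbT /= => /esym/orP[]/eqP-> /esym/orP[]/eqP->;
    rewrite !eqxx ?orbT.
(* Two distinct elements of [T] form one of the three pairs already excluded. *)
rewrite expr0n /=; case: andP => // -[]; rewrite !inE => uT vT; exfalso.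
move: uv Nabbc Nac.
by case/or3P: uT => /eqP ->; case/or3P: vT => /eqP ->;
  rewrite ?eqxx ?orbT // fsetUC ?eqxx ?orbT.
Qed.

Lemma incidence_sqr_sum (R : numDomainType) d (V : orderType d) (T : {fset V})
    (E : seq {fset V}) :
  uniq E -> #|` T| = 3%N -> \sum_(e <- E) incidence R T e ^+ 2 <= 3.
Proof.
move=> uE /card3_sorted[a [b [c [sT _ _]]]].
pose s := [:: [fset a; b]; [fset b; c]; [fset a; c]].
have -> : \sum_(e <- E) incidence R T e ^+ 2 = \sum_(e <- E) (e \in s)%:R.
  apply: eq_bigr => e _; rewrite /incidence sT !inE orbA.
  case: ifP => _; rewrite ?expr1n //=.
  by case: eqP => _; rewrite ?sqrrN ?expr1n ?expr0n.
rewrite -natr_sum sum_nat_of_bool ler_nat -size_filter.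
rewrite -[leqRHS]/(size s); apply: uniq_leq_size; first exact: filter_uniq.
by move=> e; rewrite mem_filter => /andP[].
Qed.

(** * Edge degrees and the bound they give on [lambda] *)

Section EdgeDegree.
Context {d : Order.disp_t} {V : orderType d}.
Variable F : {fset {fset V}}.
Hypothesis triF : triple_family F.

Definition edge_degree (e : {fset V}) : nat := (\sum_(T <- F) (e `<=` T))%N.

(** The union of two distinct pairs has at least three elements, so it fills any triple containing
    both. *)
Lemma fsub_triple_inj (e f T T' : {fset V}) :
  #|` e| = 2%N -> #|` f| = 2%N -> e != f -> #|` T| = 3%N -> #|` T'| = 3 ->
  e `<=` T -> f `<=` T -> e `<=` T' -> f `<=` T' -> T = T'.
Proof.
move=> e2 f2 ef T3 T'3 eT fT eT' fT'.
have ef3 : (2 < #|` e `|` f|)%N.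
  rewrite -[2%N]e2; apply: fproper_ltn_card.
  rewrite fproperEneq fsubsetUl andbT.
  apply: contra ef => /eqP/esym/fsetUidPl fe.
  by rewrite eq_sym eqEfcard fe e2 f2.
have eqU (U : {fset V}) : #|` U| = 3%N -> e `<=` U -> f `<=` U -> e `|` f = U.
  by move=> U3 eU fU; apply/eqP; rewrite eqEfcard fsubUset eU fU U3.
by rewrite -(eqU T) // -(eqU T').
Qed.

Lemma fsub_support_vertices (T : {fset V}) :
  T \in F -> T `<=` support_vertices F.
Proof.
by move=> TF; apply/fsubsetP => x xT; apply/bigfcupP; exists T; rewrite ?TF.
Qed.

Lemma support_edgesP (e : {fset V}) : reflect
  (#|` e| = 2%N /\ exists2 T, T \in F & e `<=` T) (e \in support_edges F).
Proof.
rewrite /support_edges !inE /= fpowersetE; apply: (iffP and3P).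
  move=> [_ /eqP e2 /existsP[T eT]]; split=> //.
  by exists (val T) => //; exact: valP.
move=> [e2 [T TF eT]]; split; rewrite ?e2 //.
  exact: fsubset_trans eT (fsub_support_vertices TF).
by apply/existsP; exists [` TF].
Qed.

Lemma edge_degree_gt0 e : e \in support_edges F -> (0 < edge_degree e)%N.
Proof.
move=> /support_edgesP[_ [T TF eT]].
by rewrite /edge_degree sum_nat_of_bool -has_count; apply/hasP; exists T.
Qed.

Lemma lambda_le_edge_degree (R : realType) e : e \in support_edges F ->
  lambda R F <= (edge_degree e)%:R + 2.
Proof.
move=> eE; pose D := coboundary R F; pose S := D^T *m D.
have F3 T : T \in F -> #|` T| = 3%N by exact: triF.2.
have [[lev l0] lmin] := lambda_min triF R.
have St : S^T = S by rewrite /S trmx_mul trmxK.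
have iE := eE; rewrite -index_mem in iE; pose j := Ordinal iE.
pose tr (i : 'I_(#|` F|)) := nth fset0 (enum_fset F) i.
pose ed (k : 'I_(#|` support_edges F|)) :=
  nth fset0 (enum_fset (support_edges F)) k.
have trF i : tr i \in F by exact: mem_nth.
have ed2 k : #|` ed k| = 2.
  by have /support_edgesP[] : ed k \in support_edges F by exact: mem_nth.
have edj : ed j = e by exact: nth_index.
have DE i k : D i k ^+ 2 = (ed k `<=` tr i)%:R.
  by rewrite mxE; apply: incidence_sqr; [exact: F3 _ (trF i) | exact: ed2].
have SE k : S j k = \sum_i D i j * D i k.
  by rewrite mxE; apply: eq_bigr => i _; rewrite mxE.
have degE : (edge_degree e)%:R = \sum_i D i j ^+ 2.
  rewrite /edge_degree (big_nth fset0) big_mkord natr_sum.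
  by apply: eq_bigr => i _; rewrite DE edj.
have SjjE : S j j = (edge_degree e)%:R.
  by rewrite SE degE; apply: eq_bigr => i _; rewrite expr2.
(* At most one triple contains two distinct edges, so at most one term of [SE k] is nonzero and
   squaring passes inside the sum. *)
have SjkE k : k != j -> S j k ^+ 2 = \sum_i D i j ^+ 2 * D i k ^+ 2.
  move=> kj; rewrite SE sqr_sum_orthogonal.
    by apply: eq_bigr => i _; rewrite exprMn.
  (* Vanishing is tested on the square, where [DE] turns entries into containment indicators. *)
  move=> i i' ii'; apply/eqP; rewrite -[_ == 0]negbK -sqrf_eq0 !exprMn !DE.
  rewrite !mulf_eq0 !pnatr_eq0 !eqb0 -!negb_and negbK.
  apply: contra ii' => /andP[/andP[h1 h2] /andP[h3 h4]].
  rewrite -(inj_eq val_inj).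
  rewrite -(nth_uniq fset0 (ltn_ord i) (ltn_ord i') (fset_uniq F)).
  apply/eqP; apply: (@fsub_triple_inj (ed j) (ed k)) => //;
    try by [exact: F3 _ (trF i) | exact: F3 _ (trF i')].
  by rewrite nth_uniq ?fset_uniq // eq_sym.
(* A triple through [e] has three pairs, hence at most two edges other than [e]. *)
have rowsum i : \sum_(k | k != j) D i j ^+ 2 * D i k ^+ 2 <= D i j ^+ 2 * 2.
  rewrite -mulr_sumr DE; case eT : (ed j `<=` tr i); last by rewrite !mul0r.
  rewrite !mul1r -(lerD2l 1) (_ : 1 + 2 = 3); last by rewrite -(natrD _ 1 2).
  have := incidence_sqr_sum R (fset_uniq (support_edges F)) (F3 _ (trF i)).
  apply: le_trans.
  rewrite (big_nth fset0) big_mkord [leRHS](bigD1 j) //=.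
  apply: lerD; last by apply: ler_sum => k _; rewrite mxE.
  by have := DE i j; rewrite eT mxE => ->.
have := symmetric_sqr_diag_ge j St (ltW l0)
  (fun a ev a0 => lmin a (conj ev a0)).
have -> : (S *m S) j j = \sum_k S j k ^+ 2.
  by rewrite mxE; apply: eq_bigr => k _;
    rewrite expr2 -[in LHS]St [_^T k j]mxE St.
rewrite (bigD1 j) //= (eq_bigr _ SjkE) exchange_big SjjE /= => h.
(* With the sums exchanged, the off-diagonal part is at most twice the degree; the factor
   [edge_degree e] then cancels. *)
have d0 : 0 < (edge_degree e)%:R :> R by rewrite ltr0n edge_degree_gt0.
rewrite -(ler_pM2r d0) mulrDl; apply: (le_trans h); rewrite -expr2 lerD2l.
by rewrite degE mulrC mulr_suml; apply: ler_sum.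
Qed.

End EdgeDegree.

(** * Double counting with codegrees *)

Section CodegreeCounting.
Context {K : choiceType}.
Variables (F : {fset {fset K}}) (V : {fset K}).
Hypothesis F3 : forall T, T \in F -> #|` T| = 3%N.
Hypothesis FV : forall T, T \in F -> T `<=` V.

(** Ordered pairs of vertices, instead of two-element sets, make the flag count a double sum over
    [V]. *)
Definition codegree (u v : K) : nat :=
  (\sum_(T <- F) ((u \in T) && (v \in T)))%N.

Lemma count_mem_fset (T A : {fset K}) : A `<=` T -> count (mem A) T = #|` A|.
Proof.
move=> /fsubsetP AT; rewrite -size_filter.
apply: perm_size; apply: uniq_perm; rewrite ?filter_uniq ?fset_uniq // => x.
by rewrite mem_filter /=; case xA: (x \in A) => //=; exact: AT.
Qed.

(** Each triple contains six ordered pairs of distinct vertices. *)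
Lemma six_card :
  (6 * #|` F| = \sum_(v <- V) \sum_(u <- V | u != v) codegree u v)%N.
Proof.
transitivity (\sum_(T <- F) 6)%N.
  by rewrite big_const_seq count_predT iter_addn_0.
transitivity (\sum_(T <- F) \sum_(v <- V) \sum_(u <- V | u != v)
    ((u \in T) && (v \in T)))%N; last first.
  rewrite exchange_big; apply: eq_bigr => v _.
  by rewrite exchange_big.
rewrite big_seq [RHS]big_seq; apply: eq_bigr => T TF.
transitivity (\sum_(v <- V) (v \in T) * 2)%N.
  by rewrite -big_distrl /= sum_nat_of_bool count_mem_fset ?F3 ?FV.
apply: eq_bigr => v _; case vT : (v \in T); last first.
  by rewrite big1 // => u _; rewrite andbF.
have T1 : #|` T `\ v| = 2%N.
  by have := F3 TF; rewrite (cardfsD1 v) vT add1n => -[->].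
rewrite -[LHS]T1 -(@count_mem_fset V); last first.
  by apply: fsubset_trans (FV TF); exact: fsubD1set.
rewrite -sum_nat_of_bool [RHS]big_mkcond; apply: eq_bigr => u _.
by rewrite !inE andbT; case: eqP.
Qed.

(** A triple through [u] and [v] is determined by its third vertex [w], and it witnesses that [w] is
    a neighbour of [v]. *)
Lemma codegree_le u v : u != v -> (codegree u v <=
  count (fun w => [&& w != u, w != v & (0 < codegree w v)%N]) V)%N.
Proof.
move=> uv; rewrite -sum_nat_of_bool /codegree.
have -> : (\sum_(T <- F) ((u \in T) && (v \in T)) =
    \sum_(w <- V) \sum_(T <- F)
      [&& w != u, w != v, u \in T, v \in T & w \in T])%N.
  rewrite exchange_big /= big_seq [RHS]big_seq; apply: eq_bigr => T TF.
  case uT : (u \in T); last by rewrite big1 // => w _; rewrite !andbF.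
  case vT : (v \in T); last by rewrite big1 // => w _; rewrite !andbF.
  have : #|` T `\ u `\ v| = 1%N.
    have := F3 TF; rewrite (cardfsD1 u) uT (cardfsD1 v) !inE eq_sym uv vT.
    by move=> -[].
  rewrite -(@count_mem_fset V); last first.
    by do 2!apply: (fsubset_trans (fsubD1set _ _)); exact: FV.
  rewrite -sum_nat_of_bool => c1; rewrite -[LHS]c1; apply: eq_bigr => w _.
  by rewrite !inE; case: (w == v); rewrite ?andbF.
apply: leq_sum => w _; case wu : (w == u); first by rewrite big1.
case wv : (w == v); first by rewrite big1.
rewrite sum_nat_of_bool /= [in leqRHS]sum_nat_of_bool -has_count.
have [/hasP h|/hasPn h] := boolP (has _ _); last first.
  rewrite leqNgt -has_count; apply/hasPn => T /h /=.
  by case: (w \in T); case: (v \in T); rewrite ?andbF.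
rewrite -size_filter -[leqRHS]/(size [:: [fset u; v; w]]).
apply: uniq_leq_size; first by rewrite filter_uniq ?fset_uniq.
move=> T; rewrite mem_filter inE /= => /andP[/and3P[uT vT wT] TF].
rewrite eq_sym eqEfcard F3 // !fsubUset !fsub1set uT vT wT /=.
by rewrite fsetUC cardfsU1 cardfs2 uv !inE wu wv.
Qed.

(** One neighbour [u] of [v] yields [k] further neighbours as third vertices, so [v] has at least
    [k.+1] neighbours, each contributing at least [k]. *)
Lemma sum_codegree_ge k v :
  (exists2 u, u \in V & (u != v) && (0 < codegree u v)%N) ->
  (forall u, u \in V -> u != v ->
    (0 < codegree u v)%N -> (k <= codegree u v)%N) ->
  (k.+1 * k <= \sum_(u <- V | u != v) codegree u v)%N.
Proof.
move=> [u uV /andP[uv du0]] dk.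
pose N := [pred w | (w != v) && (0 < codegree w v)%N].
have Nk : (k.+1 <= count N V)%N.
  apply: (@leq_ltn_trans (codegree u v)); first exact: dk.
  apply: (leq_ltn_trans (codegree_le uv)).
  rewrite -!size_filter.
  set s := seq.filter _ _; rewrite -[leqLHS]/(size (u :: s)).
  apply: uniq_leq_size.
    by rewrite /= mem_filter eqxx filter_uniq ?fset_uniq.
  move=> w; rewrite inE !mem_filter /= => /orP[/eqP->|/andP[/andP[_ ->] ->]] //.
  by rewrite uv du0.
apply: (@leq_trans (count N V * k)); first by rewrite leq_mul2r Nk orbT.
rewrite -sum_nat_of_bool big_distrl /= [leqRHS]big_mkcond.
rewrite big_seq [leqRHS]big_seq; apply: leq_sum => w wV /=.
case: ifP => wv; last by rewrite mul0n.
by have [->|d0] := posnP (codegree w v); rewrite ?mul0n // mul1n dk.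
Qed.

Lemma six_card_le : (6 * #|` F| <= #|` V| * (#|` V|.-1 * #|` V|.-2))%N.
Proof.
rewrite six_card.
have cD v : v \in V -> count (predC1 v) V = #|` V|.-1.
  move=> vV; have := count_predC (pred1 v) V.
  by rewrite count_uniq_mem ?fset_uniq // vV => <-.
have -> : (#|` V| * (#|` V|.-1 * #|` V|.-2) =
    \sum_(v <- V) \sum_(u <- V | u != v) #|` V|.-2)%N.
  rewrite [LHS](_ : _ = \sum_(v <- V) (#|` V|.-1 * #|` V|.-2))%N; last first.
    by rewrite big_const_seq count_predT iter_addn_0 mulnC.
  rewrite big_seq [RHS]big_seq; apply: eq_bigr => v vV.
  by rewrite big_const_seq iter_addn_0 mulnC -(cD v vV).
rewrite big_seq [leqRHS]big_seq; apply: leq_sum => v vV.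
rewrite big_seq_cond [leqRHS]big_seq_cond; apply: leq_sum => u /andP[uV uv].
apply: (leq_trans (codegree_le uv)).
have -> : #|` V|.-2 = count (predC (mem [fset u; v])) V.
  have := count_predC (mem [fset u; v]) V.
  rewrite count_mem_fset; last by rewrite fsubUset !fsub1set uV vV.
  by rewrite cardfs2 uv => <-.
apply: sub_count => w /= /and3P[wu wv _].
by rewrite !inE negb_or wu wv.
Qed.

End CodegreeCounting.

(** * From a minimum edge degree to the size of the family *)

Lemma codegree_edge_degree d (V : orderType d) (F : {fset {fset V}}) (u v : V) :
  codegree F u v = edge_degree F [fset u; v].
Proof. by apply: eq_bigr => T _; rewrite fsub2set. Qed.

(** Every support vertex lies in a triple and so has a neighbour; [sum_codegree_ge] then applies at
    each vertex. *)
Lemma six_card_ge d (V : orderType d) (F : {fset {fset V}}) (k : nat) :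
  triple_family F ->
  (forall e, e \in support_edges F -> (k <= edge_degree F e)%N) ->
  (#|` support_vertices F| * (k.+1 * k) <= 6 * #|` F|)%N.
Proof.
move=> triF dk; have F3 T : T \in F -> #|` T| = 3%N by exact: triF.2.
have FV := @fsub_support_vertices _ _ F.
have edge u v T : u != v -> T \in F -> u \in T -> v \in T ->
    [fset u; v] \in support_edges F.
  move=> uv TF uT vT; apply/support_edgesP; split; first by rewrite cardfs2 uv.
  by exists T; rewrite // fsub2set uT.
rewrite (six_card F3 FV).
rewrite [leqLHS](_ : _ =
  \sum_(v <- support_vertices F) (k.+1 * k))%N; last first.
  by rewrite big_const_seq count_predT iter_addn_0 mulnC.
rewrite big_seq [leqRHS]big_seq.
apply: leq_sum => v /bigfcupP[T /andP[TF _] vT].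
apply: (sum_codegree_ge F3 FV).
  have /fset0Pn[u] : T `\ v != fset0.
    rewrite -cardfs_gt0; have := F3 T TF.
    by rewrite (cardfsD1 v) vT add1n => -[->].
  rewrite !inE => /andP[uv uT]; exists u.
    exact: (fsubsetP (FV _ TF)).
  by rewrite uv codegree_edge_degree edge_degree_gt0 // (edge u v T).
move=> u _ uv; rewrite {1}/codegree sum_nat_of_bool -has_count.
move=> /hasP[U UF /andP[uU vU]].
by rewrite codegree_edge_degree dk // (edge u v U).
Qed.

(** * The bound on [phi] *)

Unset Implicit Arguments.

Theorem theorem3p11 (R : realType) (n m : nat)
    (n_ge3 : (3 <= n)%N) (m_ge1 : (1 <= m)%N)
    (m_cond : 3 / 2 * (m%:R - 1) * (m%:R + 2) < 'C(n - 1, 2)%:R :> R)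
    (m_max : forall k : nat, (1 <= k)%N ->
      3 / 2 * (k%:R - 1) * (k%:R + 2) < 'C(n - 1, 2)%:R :> R -> (k <= m)%N)
    (t : nat)
    (t_range : ('C(n, 3) + 1 <= t <= 'C(n, 3) + 'C(m + 1, 2) - 1)%N) :
  phi R t <= n%:R - 1.
Proof.
have t0 : (0 < t)%N by lia.
have [[d [V [F [triF Ft ->]]]] _] := phi_max R t0.
rewrite leNgt; apply/negP => lam_gt.
(* From here [n] is [p.+3], so the edge degree bound [n - 2] reads [p.+1]. *)
case: n n_ge3 m_cond {m_max} t_range lam_gt => [|[|[|p]]] // _.
rewrite subSS subn0 (addn1 m) => m_cond t_range lam_gt.
have binm : (2 * 'C(m.+1, 2) = m.+1 * m)%N by rewrite -mul_bin_diag bin1.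
have binp : (2 * 'C(p.+2, 2) = p.+2 * p.+1)%N by rewrite -mul_bin_diag bin1.
have bint : (6 * 'C(p.+3, 3) = p.+3 * (p.+2 * p.+1))%N.
  by rewrite -binp mulnCA (mul_bin_diag p.+3 2) mulnA.
(* This is [m_cond] doubled, as [(m - 1) * (m + 2) = m * (m + 1) - 2]. *)
have mN : (3 * (m.+1 * m) < p.+2 * p.+1 + 6)%N.
  rewrite -binp -(ltr_nat R) natrD !natrM -[m.+1%:R]natr1; move: m_cond; lra.
have dk e : e \in support_edges F -> (p.+1 <= edge_degree F e)%N.
  move=> eE; have := lt_le_trans lam_gt (lambda_le_edge_degree triF R eE).
  by rewrite ltrBlDr -natrD natr1 ltr_nat; lia.
have lower := six_card_ge triF dk.
have upper := @six_card_le _ F (support_vertices F) triF.2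
  (@fsub_support_vertices _ _ F).
rewrite Ft in lower upper.
(* The upper end of the range and [mN] give [6 * t < p.+4 * (p.+2 * p.+1)]; comparison with [lower]
   bounds the number of vertices. *)
have Nle : (#|` support_vertices F| <= p.+3)%N.
  rewrite -ltnS -(@ltn_pmul2r (p.+2 * p.+1)) ?muln_gt0 //.
  apply: leq_ltn_trans lower _.
  by rewrite [ltnRHS]mulSn -bint; lia.
(* With at most [n] vertices, [t] cannot exceed ['C(n, 3)], against the lower end of the range. *)
have : (6 * t <= p.+3 * (p.+2 * p.+1))%N.
  by apply: leq_trans upper _; apply: leq_mul => //; apply: leq_mul; lia.
by rewrite -bint; lia.
Qed.
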